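(* Let $N$ be a finite nonempty set of players. Let $\Phi$ be the Poisson-equation value and $\Psi$ the random-walk path-integral value defined in the context. Then $\Phi=\Psi$, that is, $$\Phi_i(v,S)=\Psi_i(v,S)\quad\text{for all } v\in\mathcal G_N,\ S\subseteq N,\ i\in N.$$ In particular, the classic Shapley value is recovered for the grand coalition: $\phi_i(v)=\Psi_i(v,N)$ for every $v\in\mathcal G_N$ and $i\in N$, where $$\phi_i(v)=\sum_{S\subseteq N\setminus\{i\}}\frac{|S|!\,(|N|-|S|-1)!}{|N|!}\bigl(v(S\cup\{i\})-v(S)\bigr).$$
   Context: The set of coalition games on $N$ is $\mathcal G_N=\{v:2^N\to\mathbb R\mid v(\varnothing)=0\}$, where $2^N$ is the set of all subsets of $N$. Hypercube graph: the vertex set is $\mathcal V=2^N$. The forward edges are $\mathcal E=\{(S,S\cup\{i\}) : i\in N,\ S\subseteq N\setminus\{i\}\}$, the reverse edges are $\mathcal E_-=\{(S\cup\{i\},S): i\in N,\ S\subseteq N\setminus\{i\}\}$, and $\overline{\mathcal E}=\mathcal E\cup\mathcal E_-$. We write $T\sim S$ if $T$ and $S$ are adjacent, i.e. $(T,S)\in\overline{\mathcal E}$. Partial differential: for $v\in\mathcal G_N$ and $i\in N$, $\partial_i v:\overline{\mathcal E}\to\mathbb R$ is defined, for $j\in N$ and $S\subseteq N\setminus\{j\}$, by $\partial_i v(S,S\cup\{j\})=v(S\cup\{i\})-v(S)$ if $j=i$, and $\partial_i v(S,S\cup\{j\})=0$ if $j\neq i$; and $\partial_i v(S\cup\{j\},S)=-\partial_i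 v(S,S\cup\{j\})$. Definition of $\Phi$: for $v\in\mathcal G_N$ and $i\in N$, $\Phi_i(v,\cdot):2^N\to\mathbb R$ is the unique function with $\Phi_i(v,\varnothing)=0$ satisfying $$\Phi_i(v,S)-\frac1{|N|}\sum_{T\sim S}\Phi_i(v,T)=\frac1{|N|}\sum_{T\sim S}\partial_i v(T,S)\qquad\text{for all } S\subseteq N.$$ Definition of $\Psi$: let $(X_t)_{t\in\mathbb N_0}$ be the Markov chain on $\mathcal V$, on a probability space $(\Omega,\mathcal F,\mathcal P)$, with $X_0=\varnothing$ and transition probabilities $p_{S,T}=1/|N|$ if $T\sim S$ and $p_{S,T}=0$ otherwise. For $S\in\mathcal V$, let $\tau_S$ be the first time $t\ge 1$ such that $X_t=S$ (finite almost surely). Define $$\mathcal I_i(v,S)=\sum_{t=1}^{\tau_S}\partial_i v(X_{t-1},X_t),\qquad \Psi_i(v,S)=\mathbb E[\mathcal I_i(v,S)].$$ *)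

(* Defs.v *)
From HB Require Import structures.
From mathcomp Require Import all_boot all_order all_algebra.
From mathcomp Require Import all_classical all_reals all_analysis.
From mathcomp Require Import ring lra.

Set Implicit Arguments.
Unset Strict Implicit.
Unset Printing Implicit Defensive.

Import Order.TTheory GRing.Theory Num.Theory.

Local Open Scope ring_scope.

(* [set0], [setT] also name classical sets, so the finset versions are
   qualified. *)

Section Hypercube.
Variable N : finType.
Implicit Types (i j : N) (S T : {set N}).

Definition forward_edge S T : bool :=
  [exists j, (j \notin S) && (T == (j |: S)%SET)].

Definition adjacent T S : bool := forward_edge T S || forward_edge S T.

(* Time of the first visit to S at a time t >= 1, [None] if there is none. *)
Definition first_visit (x : nat -> {set N}) S : option nat :=
  if pselect (exists t, (0 < t)%N && (x t == S)) is left h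
  then Some (ex_minn h) else None.

End Hypercube.

Section Values.
Variables (R : realType) (N : finType).
Implicit Types (v : {set N} -> R) (i : N) (S T : {set N}).

Definition coalition_game v : Prop := v finset.set0 = 0.

Definition forward_partial v i S T : R :=
  if (i \notin S) && (T == (i |: S)%SET) then v (i |: S)%SET - v S else 0.

(* Total in (S, T); only its values on edges are meaningful. *)
Definition partial v i S T : R :=
  if forward_edge S T then forward_partial v i S T
  else if forward_edge T S then - forward_partial v i T S
  else 0.

Definition poisson_solution v i (f : {set N} -> R) : Prop :=
  f finset.set0 = 0 /\
  forall S, f S - #|N|%:R^-1 * (\sum_(T | adjacent T S) f T)
            = #|N|%:R^-1 * (\sum_(T | adjacent T S) partial v i T S).

(* Definite description; see [poisson_solution_unique] and [PhiP] below. *)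
Definition Phi v i : {set N} -> R :=
  xget (fun=> 0) [set f | poisson_solution v i f]%classic.

Definition transition S T : R := if adjacent T S then #|N|%:R^-1 else 0.

(* The value 0 when S is never visited at a time t >= 1 is a convention: along
   the walk below this event is negligible. *)
Definition path_integral v i S (x : nat -> {set N}) : R :=
  if first_visit x S is Some tau
  then \sum_(1 <= t < tau.+1) partial v i (x t.-1) (x t)
  else 0.

Definition shapley v i : R :=
  \sum_(S : {set N} | S \subset [set~ i]%SET)
    (((#|S|)`! * (#|N| - #|S| - 1)`!)%N%:R / ((#|N|)`!)%:R)
      * (v (i |: S)%SET - v S).

End Values.

Section RandomWalk.
Variables (R : realType) (N : finType) (d : measure_display)
  (Omega : measurableType d) (P : probability Omega R)
  (X : nat -> Omega -> {set N}).

(* Only used for P B != 0. *)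
Definition cond_prob (A B : set Omega) : R :=
  fine (P (A `&` B)%classic) / fine (P B).

Definition event_path (t : nat) (s : nat -> {set N}) : set Omega :=
  [set w | forall k, (k <= t)%N -> X k w = s k]%classic.

Record coalition_walk : Prop := {
  walk_measurable : forall t S, measurable [set w | X t w = S]%classic;
  walk_start : P [set w | X 0%N w = finset.set0]%classic = 1%E;
  walk_markov : forall t (s : nat -> {set N}) T,
    P (event_path t s) != 0%E ->
    cond_prob [set w | X t.+1 w = T]%classic (event_path t s)
    = transition R (s t) T
}.

(* Extended-real valued: no integrability is presupposed. *)
Definition Psi (v : {set N} -> R) (i : N) (S : {set N}) : \bar R :=
  expectation P (fun w => path_integral v i S (fun t => X t w)).

End RandomWalk.

Section PoissonWellPosed.
Variables (R : realType) (N : finType).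
Implicit Types (v : {set N} -> R) (i : N) (S T : {set N}).

Definition toggle S i : {set N} := if i \in S then (S :\ i)%SET else (i |: S)%SET.

Lemma in_toggle S i k : (k \in toggle S i) = (k \in S) (+) (k == i).
Proof.
by rewrite /toggle; case: ifPn => iS; rewrite !inE; case: eqVneq => [->|_];
  rewrite ?iS ?(negbTE iS) ?addbF.
Qed.

Lemma toggleK i : involutive (toggle ^~ i).
Proof. by move=> S; apply/finset.setP => k; rewrite !in_toggle addbK. Qed.

Lemma toggle_inj S : injective (toggle S).
Proof.
move=> i j /finset.setP /(_ i); rewrite !in_toggle eqxx => /addbI.
by move/esym/eqP.
Qed.

Lemma adjacentC S T : adjacent S T = adjacent T S.
Proof. by rewrite /adjacent orbC. Qed.

Lemma adjacent_toggle S i : adjacent (toggle S i) S.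
Proof.
rewrite /adjacent /toggle; case: ifPn => iS; apply/orP; [left|right].
  by apply/existsP; exists i; rewrite finset.setD1K // !inE eqxx eqxx.
by apply/existsP; exists i; rewrite iS eqxx.
Qed.

Lemma adjacentP S T : adjacent T S -> exists i, T = toggle S i.
Proof.
case/orP => /existsP[i /andP[iT /eqP ->]]; exists i.
  by rewrite /toggle !inE eqxx /= finset.setU1K.
by rewrite /toggle (negbTE iT).
Qed.

Lemma sum_adjacent S (F : {set N} -> R) :
  \sum_(T | adjacent T S) F T = \sum_i F (toggle S i).
Proof.
have tI : {in finset.setT &, injective (toggle S)}.
  by move=> i j _ _; exact: toggle_inj.
transitivity (\sum_(i in finset.setT) F (toggle S i)); last first.
  by apply: eq_bigl => i; rewrite inE.
rewrite -(big_imset _ tI); apply: eq_bigl => T.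
apply/idP/imsetP => [/adjacentP[i ->]|[i _ ->]]; first by exists i; rewrite ?inE.
exact: adjacent_toggle.
Qed.

Lemma forward_edge_asym S T : forward_edge S T -> forward_edge T S = false.
Proof.
case/existsP => i /andP[iS /eqP ->]; apply/negbTE/existsP => -[j /andP[_ /eqP]].
by move/finset.setP => /(_ i); rewrite !inE eqxx (negbTE iS) orbT.
Qed.

Lemma partialN v i S T : partial v i S T = - partial v i T S.
Proof.
rewrite /partial; case: ifPn => [/forward_edge_asym ->|_]; first by rewrite opprK.
by case: ifPn; rewrite ?oppr0.
Qed.

Lemma sum_toggle j (F : {set N} -> R) : \sum_S F (toggle S j) = \sum_S F S.
Proof. by rewrite [RHS](reindex_inj (inv_inj (toggleK j))). Qed.

Lemma sum_partial v i :
  \sum_S \sum_(T | adjacent T S) partial v i T S = 0.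
Proof.
under eq_bigr do rewrite sum_adjacent.
rewrite exchange_big big1 //= => j _.
set x := LHS; suff : x = - x by lra.
rewrite /x -[LHS](sum_toggle j) -sumrN; apply: eq_bigr => S _.
by rewrite toggleK partialN.
Qed.

Definition laplacian (f : {set N} -> R) S : R :=
  f S - #|N|%:R^-1 * \sum_(T | adjacent T S) f T.

Lemma laplacianE (hN : (0 < #|N|)%N) f S :
  #|N|%:R * laplacian f S = \sum_j (f S - f (toggle S j)).
Proof.
have n0 : #|N|%:R != 0 :> R by rewrite pnatr_eq0 -lt0n.
rewrite /laplacian sum_adjacent mulrBr mulVKf // sumrB.
by rewrite sumr_const -cardsT finset.cardsT mulr_natl.
Qed.

Lemma sum_laplacian (hN : (0 < #|N|)%N) f : \sum_S laplacian f S = 0.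
Proof.
have n0 : #|N|%:R != 0 :> R by rewrite pnatr_eq0 -lt0n.
apply: (mulfI n0); rewrite mulr0 mulr_sumr.
under eq_bigr do rewrite laplacianE //.
rewrite exchange_big big1 //= => j _.
by rewrite sumrB sum_toggle subrr.
Qed.

Lemma laplacian_eq0 (hN : (0 < #|N|)%N) f :
  f finset.set0 = 0 -> (forall S, S != finset.set0 -> laplacian f S = 0) ->
  forall S, f S = 0.
Proof.
move=> f0 fL.
have E0 : \sum_j \sum_S (f S - f (toggle S j)) ^+ 2 = 0.
  transitivity (2 * \sum_S f S * (#|N|%:R * laplacian f S)); last first.
    rewrite big1 ?mulr0 // => S _; have [->|S0] := eqVneq S finset.set0.
      by rewrite f0 mul0r.
    by rewrite fL // !mulr0.
  under [in RHS]eq_bigr do rewrite laplacianE // mulr_sumr.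
  rewrite [in RHS]exchange_big mulr_sumr /=; apply: eq_bigr => j _.
  rewrite mulr_natl mulr2n -[in X in _ = _ + X](sum_toggle j) -big_split /=.
  by apply: eq_bigr => S _; rewrite toggleK; ring.
have fE S j : f (toggle S j) = f S.
  have F0 k : 0 <= \sum_S (f S - f (toggle S k)) ^+ 2.
    by apply: sumr_ge0 => T _; exact: sqr_ge0.
  move/eqP: E0; rewrite psumr_eq0 // => /allP /(_ j); rewrite mem_index_enum.
  move=> /(_ isT) /=; rewrite psumr_eq0; last by move=> T _; exact: sqr_ge0.
  move=> /allP /(_ S); rewrite mem_index_enum => /(_ isT) /=.
  by rewrite sqrf_eq0 subr_eq0 => /eqP.
move=> S; have [m] := ubnP #|S|; elim: m S => // m IH S.
case: (finset.set_0Vmem S) => [->//|[j jS]]; rewrite (finset.cardsD1 j) jS ltnS.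
by move=> /IH Sj0; rewrite -(fE S j) /toggle jS.
Qed.

Lemma poisson_solution_unique (hN : (0 < #|N|)%N) v i :
  exists! f, poisson_solution v i f.
Proof.
pose V := {ffun {set N} -> R^o}.
pose A (f : V) : V :=
  [ffun S => if S == finset.set0 then f S else laplacian f S].
have Alin : linear A.
  move=> a f g; apply/ffunP => S; rewrite !ffunE; case: ifP => _ //.
  rewrite /laplacian !sum_adjacent !ffunE.
  under eq_bigr do rewrite !ffunE.
  rewrite big_split /= -scaler_sumr /GRing.scale /=; ring.
pose AL := GRing.isLinear.Build _ _ _ _ A Alin.
pose A' : {linear V -> V} := HB.pack A AL.
have A0 f : A f = 0 -> f = 0.
  move=> /ffunP Af; apply/ffunP => S; rewrite [RHS]ffunE.
  apply: laplacian_eq0 => // [|T T0].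
    by have := Af finset.set0; rewrite !ffunE eqxx.
  by have := Af T; rewrite !ffunE (negbTE T0).
have ker0 : lker (linfun A') == 0%VS.
  rewrite -subv0; apply/subvP => f; rewrite memv_ker lfunE /= => /eqP /A0 ->.
  exact: mem0v.
pose r S := #|N|%:R^-1 * \sum_(T | adjacent T S) partial v i T S.
pose b : V := [ffun S => if S == finset.set0 then 0 else r S].
have [f Af] : exists f, A f = b.
  by exists ((linfun A')^-1%VF b); have := lker0_lfunVK ker0 b; rewrite lfunE.
have f0 : f finset.set0 = 0.
  by move/ffunP: Af => /(_ finset.set0); rewrite !ffunE eqxx.
have fr S : S != finset.set0 -> laplacian f S = r S.
  by move=> S0; move/ffunP: Af => /(_ S); rewrite !ffunE (negbTE S0).
exists (f : {set N} -> R); split.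
  split=> // S; have [->|] := eqVneq S finset.set0; last exact: fr.
  have : \sum_S (laplacian f S - r S) = 0.
    by rewrite sumrB sum_laplacian // -mulr_sumr sum_partial mulr0 subr0.
  rewrite (bigD1 finset.set0) //= big1 ?addr0; last first.
    by move=> T T0; rewrite fr // subrr.
  by move/eqP; rewrite subr_eq0 => /eqP.
move=> g [g0 gE]; apply/funext => S; apply/eqP; rewrite -subr_eq0; apply/eqP.
apply: (@laplacian_eq0 hN (fun T => f T - g T)) => /= [|T T0].
  by rewrite f0 g0 subrr.
transitivity (laplacian f T - laplacian g T); last first.
  by rewrite fr // [laplacian g T]gE subrr.
by rewrite /laplacian sumrB; ring.
Qed.

Lemma PhiP (hN : (0 < #|N|)%N) v i : poisson_solution v i (Phi v i).
Proof.
have [f [fP _]] := poisson_solution_unique hN v i.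
exact: (xgetPex (fun=> 0) (ex_intro _ f fP)).
Qed.

End PoissonWellPosed.

(* Main.v *)
Require Import Defs.
From mathcomp Require Import all_boot all_order all_algebra.
From mathcomp Require Import all_classical all_reals all_analysis.
From mathcomp Require Import measurable_realfun ring lra.

(** Two independent facts give the theorem: the random-walk value solves the
    Poisson equation, and the solution of that equation takes the Shapley value
    at N.

    Random walk versus Poisson equation: let f solve the Poisson equation for
    (v, i).  The equation says exactly that, from any state U, one step of the
    walk to a random neighbour T gives
    [partial v i U T + f U - f T] mean zero ([mean_martingale_increment]), so
    the sums of these increments, stopped at the time tau of the first visit to S,
    have integral 0 ([integral_stopped_sum]).  Since f telescopes and vanishes
    at the starting state, the stopped sums are eventually equal to
    [path_integral v i S - f S] on almost every trajectory, and passing to the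
    limit under the integral gives Psi = f S.  The passage is dominated
    convergence: the stopped sums are bounded by a multiple of tau, so it is
    enough that tau is integrable.  This comes from an explicit Lyapunov
    function, whose Laplacian is at least 1 off S ([exists_lyapunov]): it loses
    at least 1 in mean at each step from a state other than S, while being
    bounded.

    Poisson equation versus Shapley value: the Laplacian is symmetric, so
    the value f(N), that is, f(N) minus the value 0 of f at the empty set, is the
    pairing of the Laplacian of f with any potential G whose Laplacian is the
    indicator of N minus that of the empty set.  Such a G is
    obtained by sending a unit flow from the empty set to N, spread evenly over
    the edges of each level of the hypercube.  There are
    n! / (k! (n - k - 1)!) edges from level k to level k + 1, hence each carries
    the Shapley weight, and the pairing is Shapley's formula. *)

Set Implicit Arguments.
Unset Strict Implicit.
Unset Printing Implicit Defensive.

Import Order.TTheory GRing.Theory Num.Theory numFieldNormedType.Exports.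

Local Open Scope ring_scope.

(** * The hypercube Laplacian *)

Section Hypercube.
Variables (R : realType) (N : finType).
Hypothesis hN : (0 < #|N|)%N.
Implicit Types (f g : {set N} -> R) (S T U : {set N}) (i j : N).

Lemma card_neq0 : #|N|%:R != 0 :> R.
Proof. by rewrite pnatr_eq0 -lt0n. Qed.

Lemma laplacian_symmetric f g :
  \sum_S g S * laplacian f S = \sum_S f S * laplacian g S.
Proof.
rewrite /laplacian; under eq_bigr do rewrite mulrBr.
under [RHS]eq_bigr do rewrite mulrBr.
rewrite !sumrB; congr (_ - _); first by apply: eq_bigr => S _; rewrite mulrC.
under eq_bigr do rewrite sum_adjacent mulrCA mulr_sumr mulr_sumr.
under [RHS]eq_bigr do rewrite sum_adjacent mulrCA mulr_sumr mulr_sumr.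
rewrite exchange_big [RHS]exchange_big; apply: eq_bigr => j _ /=.
rewrite -[LHS](sum_toggle j); apply: eq_bigr => S _.
by rewrite toggleK [g _ * _]mulrC.
Qed.

Lemma card_toggle S i :
  #|toggle S i| = if i \in S then #|S|.-1 else #|S|.+1.
Proof.
rewrite /toggle; case: ifPn => iS; last by rewrite finset.cardsU1 iS.
by rewrite [in RHS](finset.cardsD1 i) iS.
Qed.

(** Both orientations of an edge in direction i give the same formula: the sign
    of the reverse edge and the order of its endpoints compensate. *)
Lemma partial_toggle v i j S :
  partial v i (toggle S j) S =
  (if i == j then v S - v (toggle S i) else 0) :> R.
Proof.
have up T k : k \notin T ->
    partial v i T (k |: T)%SET = (if i == k then v (i |: T)%SET - v T else 0) :> R.
  move=> kT; rewrite /partial /forward_partial ifT; last first.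
    by apply/existsP; exists k; rewrite kT eqxx.
  case: (eqVneq i k) => [->|ik]; first by rewrite kT eqxx.
  rewrite ifF //; apply/negbTE/andP => -[iT /eqP/finset.setP/(_ i)].
  by rewrite !inE (negbTE ik) (negbTE iT) eqxx.
have [jS|jS] := boolP (j \in S).
  have TE : toggle S j = (S :\ j)%SET by rewrite /toggle jS.
  have := up (S :\ j)%SET j; rewrite finset.setD1K // TE => -> //; last first.
    by rewrite !inE eqxx.
  by case: (eqVneq i j) => // ->; rewrite finset.setD1K // TE.
rewrite partialN {1}/toggle (negbTE jS) up //.
by case: (eqVneq i j) => [->|_]; rewrite ?oppr0 // /toggle (negbTE jS) opprB.
Qed.

Definition shapley_weight (n k : nat) : R :=
  (k`! * (n - k - 1)`!)%N%:R / (n`!)%:R.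

(** The factor [#|N|] cancels the averaging in the Laplacian, so that the edge
    from level k to level k + 1 carries the flow [shapley_weight #|N| k]. *)
Definition shapley_potential S : R :=
  #|N|%:R * \sum_(0 <= k < #|S|) shapley_weight #|N| k.

(** Conservation of the flow: a vertex of level k receives [k * w (k - 1)] from
    below and sends [(n - k) * w k] above; both are k! (n - k)! / n!, except
    that nothing enters the bottom and nothing leaves the top. *)
Lemma laplacian_shapley_potential S :
  laplacian shapley_potential S =
  (S == finset.setT)%:R - (S == finset.set0)%:R.
Proof.
set w := shapley_weight #|N|.
have Sn : (#|S| <= #|N|)%N by exact: max_card.
have nf : ((#|N|)`!)%:R != 0 :> R by rewrite pnatr_eq0 -lt0n fact_gt0.
have LE : laplacian shapley_potential S =
    #|S|%:R * w #|S|.-1 - (#|N| - #|S|)%N%:R * w #|S|.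
  apply: (mulfI card_neq0); rewrite laplacianE //.
  have step j : shapley_potential S - shapley_potential (toggle S j) =
      #|N|%:R * (if j \in S then w #|S|.-1 else - w #|S|).
    rewrite /shapley_potential card_toggle -mulrBr; congr (_ * _).
    case: ifPn => jS; last by rewrite big_nat_recr //= opprD addrA subrr add0r.
    have S0 : (0 < #|S|)%N by apply/card_gt0P; exists j.
    by rewrite -[in X in X - _](prednK S0) big_nat_recr //= addrAC subrr add0r.
  under eq_bigr do rewrite step.
  rewrite -mulr_sumr big_if /= !sumr_const; congr (_ * _).
  rewrite mulNrn !mulr_natl; congr (_ - _ *+ _).
  by rewrite -(cardC (mem S)) addKn.
have wl k : (k < #|N|)%N ->
    k.+1%:R * w k = ((k.+1)`! * (#|N| - k.+1)`!)%:R / ((#|N|)`!)%:R.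
  move=> kn; rewrite /w /shapley_weight mulrA -natrM mulnA -factS; congr (_%:R / _).
  by rewrite -subnDA addn1.
have wr k : (k < #|N|)%N ->
    (#|N| - k)%N%:R * w k = (k`! * (#|N| - k)`!)%:R / ((#|N|)`!)%:R.
  move=> kn; rewrite /w /shapley_weight mulrA -natrM mulnCA.
  congr ((_ * _)%:R / _).
  by rewrite subn1; move: kn; rewrite -subn_gt0; case: (#|N| - k)%N.
rewrite LE eqEcard finset.subsetT /= finset.cardsT -cards_eq0.
have [S0|S0] := posnP #|S|.
  rewrite S0 mul0r sub0r wr // fact0 mul1n subn0 divff // leqNgt hN.
  by rewrite sub0r.
rewrite subr0.
have -> : #|S|%:R * w #|S|.-1 = ((#|S|)`! * (#|N| - #|S|)`!)%:R / ((#|N|)`!)%:R.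
  by have := wl #|S|.-1; rewrite prednK //; apply.
have [Sn'|Sn'] := ltnP #|S| #|N|; first by rewrite wr // subrr.
have -> : #|S| = #|N| by apply/eqP; rewrite eqn_leq Sn.
by rewrite subnn mul0r subr0 fact0 muln1 divff.
Qed.

(** Pairing the Poisson equation with the potential leaves only the edges in
    direction i, each weighted by the flow through it. *)
Lemma poisson_solution_shapley v i f :
  poisson_solution v i f -> f finset.setT = shapley v i.
Proof.
move=> [f0 fL].
have -> : f finset.setT = \sum_S shapley_potential S * laplacian f S.
  rewrite laplacian_symmetric.
  under eq_bigr do rewrite laplacian_shapley_potential mulrBr.
  rewrite sumrB (bigD1 finset.setT) //= eqxx mulr1 big1 ?addr0; last first.
    by move=> S /negbTE ->; rewrite mulr0.
  rewrite (bigD1 finset.set0) //= eqxx f0 mul0r add0r big1 ?subr0 //.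
  by move=> S /negbTE ->; rewrite mulr0.
under eq_bigr => S _.
  rewrite /laplacian fL sum_adjacent (bigD1 i) //= big1 ?addr0; last first.
    by move=> j ji; rewrite partial_toggle eq_sym (negbTE ji).
  rewrite partial_toggle eqxx; over.
rewrite (bigID (fun S => i \notin S)) /=.
rewrite [X in _ + X](reindex_inj (inv_inj (toggleK i))) /=.
under [X in _ + X]eq_bigl do rewrite in_toggle eqxx addbT negbK.
rewrite -big_split /= /shapley; apply: eq_big => S.
  apply/idP/fintype.subsetP => [iS k kS|/(_ i) iS]; rewrite ?inE.
    by apply: contraNneq iS => <-.
  by apply/negP => /iS; rewrite !inE eqxx.
move=> iS; rewrite toggleK /shapley_potential card_toggle (negbTE iS).
rewrite big_nat_recr //= /toggle (negbTE iS) -/(shapley_weight _ _).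
by have := card_neq0; move: (\sum_(0 <= k < _) _) => x n0; field.
Qed.

(** The witness decreases exponentially with the number of players on which U
    and S agree.  If U differs from S at j, then toggling j multiplies the
    weight w by n + 1, a gain of n w; each of the other n - 1 directions loses
    at most w.  The gain wins by w, which is at least 1. *)
Lemma exists_lyapunov S :
  exists h : {set N} -> R, forall U, U != S -> 1 <= laplacian h U.
Proof.
pose q : R := #|N|.+1%:R.
pose a U k : R := if (k \in U) == (k \in S) then q else 1.
pose w U := \prod_k a U k.
have q1 : 1 <= q by rewrite ler1n.
have w1 U : 1 <= w U.
  rewrite /w; elim/big_ind: _ => // [x y|k _]; first exact: mulr_ege1.
  by rewrite /a; case: ifP.
have q0 : q != 0 by rewrite pnatr_eq0.
have wt U j : w (toggle U j) =
    w U * (if (j \in U) == (j \in S) then q^-1 else q).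
  rewrite /w (bigD1 j) //= [in RHS](bigD1 j) //= mulrAC; congr (_ * _).
    rewrite /a in_toggle eqxx addbT.
    by case: (j \in U); case: (j \in S); rewrite //= ?mul1r ?divff.
  by apply: eq_bigr => k kj; rewrite /a in_toggle (negbTE kj) addbF.
exists (fun U => - (#|N|%:R * w U)) => U US.
have [j jU] : exists j, (j \in U) != (j \in S).
  apply/existsP; rewrite -negb_forall; apply: contra US => /forallP e.
  by apply/eqP/finset.setP => k; apply/eqP.
have -> : laplacian (fun U => - (#|N|%:R * w U)) U = \sum_k (w (toggle U k) - w U).
  apply: (mulfI card_neq0); rewrite laplacianE // mulr_sumr.
  by apply: eq_bigr => k _; ring.
have iq : 0 <= q^-1 by rewrite invr_ge0 ler0n.
rewrite (bigD1 j) //= wt (negbTE jU).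
have : \sum_(k | k != j) (- w U) <= \sum_(k | k != j) (w (toggle U k) - w U).
  apply: ler_sum => k _; rewrite lerDr; exact: le_trans (w1 _).
move=> wk; apply: le_trans (lerD (lexx _) wk).
(* what remains is [1 <= w * (n + 1) - w - (n - 1) * w] *)
rewrite sumr_const -mulr_natl (_ : #|_| = #|N|.-1); last first.
  by rewrite -(cardC1 j); apply: eq_card => k; rewrite !inE.
have := w1 U; rewrite /q -(prednK hN) /= -natr1 -natr1; lra.
Qed.

End Hypercube.

(** * Sums along a trajectory stopped at the first visit *)

Section Trajectories.
Variables (R : realType) (N : finType).
Implicit Types (x y : nat -> {set N}) (f : {set N} -> R) (S T U : {set N}).

(** Time 0 is excluded: a walk started at S has not visited S until it returns.
    On trajectories, this is the event that the first visit comes after t. *)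
Definition unvisited S x t : bool := all (fun k => x k != S) (iota 1 t).

Lemma unvisitedS S x t : unvisited S x t.+1 = unvisited S x t && (x t.+1 != S).
Proof. by rewrite /unvisited -{1}[t.+1]addn1 iotaD all_cat /= andbT add1n. Qed.

Lemma eq_unvisited S x y t :
  (forall k, (k <= t)%N -> x k = y k) -> unvisited S x t = unvisited S y t.
Proof.
move=> xy; apply: eq_in_all => k; rewrite mem_iota => /andP[_ kt].
by rewrite xy // -ltnS -add1n.
Qed.

Lemma first_visit_some S x tau : first_visit x S = Some tau ->
  [/\ (0 < tau)%N, x tau = S & forall t, unvisited S x t = (t < tau)%N].
Proof.
rewrite /first_visit; case: pselect => // h [<-].
case: ex_minnP => m /andP[m0 /eqP xm] mmin; split=> // t.
apply/allP/idP => [nv|tm k].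
  rewrite ltnNge; apply/negP => mt.
  by have := nv m; rewrite mem_iota m0 add1n ltnS mt xm eqxx => /(_ isT).
rewrite mem_iota add1n ltnS => /andP[k0 kt]; apply/negP => xk.
by have := mmin k; rewrite k0 xk => /(_ isT); rewrite leqNgt (leq_ltn_trans kt tm).
Qed.

Lemma first_visit_none S x t : first_visit x S = None -> unvisited S x t.
Proof.
rewrite /first_visit; case: pselect => // nh _; apply/allP => k.
rewrite mem_iota => /andP[k0 _]; apply/negP => xk; apply: nh.
by exists k; rewrite k0.
Qed.

(** The step from [s] to [s.+1] counts when the first visit comes after [s];
    written with an indicator, each term depends on finitely many steps only,
    even on trajectories that never visit S. *)
Definition stopped_sum (phi : {set N} -> {set N} -> R) S x t : R :=
  \sum_(0 <= s < t) (unvisited S x s)%:R * phi (x s) (x s.+1).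

Lemma stopped_sum_visited phi S x tau t :
  first_visit x S = Some tau -> (tau <= t)%N ->
  stopped_sum phi S x t = \sum_(0 <= s < tau) phi (x s) (x s.+1).
Proof.
move=> /first_visit_some[_ _ uE] taut; rewrite /stopped_sum.
rewrite (big_cat_nat _ taut) //= [X in _ + X]big1_seq ?addr0; last first.
  move=> s; rewrite mem_index_iota => /andP[_ /andP[ts _]].
  by rewrite uE ltnNge ts mul0r.
by apply: eq_big_nat => s /andP[_ st]; rewrite uE st mul1r.
Qed.

(** U is the state of the stopped trajectory at time t; only its existence
    matters for bounds. *)
Lemma stopped_sum_telescope h S x t :
  exists U, stopped_sum (fun V W => h V - h W) S x t = h (x 0%N) - h U.
Proof.
(* while S is unvisited, the stopped trajectory is still at [x t] *)
suff [U [? _]] : exists U,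
    stopped_sum (fun V W => h V - h W) S x t = h (x 0%N) - h U /\
    (unvisited S x t -> U = x t) by exists U.
elim: t => [|t [U [IH Ut]]].
  by exists (x 0%N); rewrite /stopped_sum big_geq // subrr.
have -> : stopped_sum (fun V W => h V - h W) S x t.+1 =
    h (x 0%N) - h U + (unvisited S x t)%:R * (h (x t) - h (x t.+1)).
  by rewrite -IH /stopped_sum big_nat_recr.
have [ut|ut] := boolP (unvisited S x t).
  by exists (x t.+1); split => //; rewrite Ut // mul1r addrA subrK.
by exists U; rewrite mul0r addr0 unvisitedS (negbTE ut).
Qed.

(** The left-hand side is the martingale of the optional stopping argument. *)
Lemma path_integral_stopped v i S f x :
  first_visit x S != None ->
  \forall t \near \oo%classic,
    stopped_sum (fun U V => partial v i U V + f U - f V) S x t =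
    path_integral v i S x + f (x 0%N) - f S.
Proof.
case fv : (first_visit x S) => [tau|//] _; exists tau => // t /= taut.
rewrite (stopped_sum_visited _ fv taut) /path_integral fv.
have [_ <- _] := first_visit_some fv.
under eq_bigr do rewrite -addrA; rewrite big_split /= -addrA; congr (_ + _).
  by rewrite big_add1.
by under eq_bigr do rewrite -opprB; rewrite sumrN telescope_sumr // opprB.
Qed.

End Trajectories.

(** * One-step means of the walk *)

Section StepMeans.
Variables (R : realType) (N : finType).
Hypothesis hN : (0 < #|N|)%N.
Implicit Types (f : {set N} -> R) (S T U : {set N}).

Lemma sum_transition U (F : {set N} -> R) :
  \sum_T transition R U T * F T = #|N|%:R^-1 * \sum_(T | Defs.adjacent T U) F T.
Proof.
rewrite mulr_sumr [RHS]big_mkcond; apply: eq_bigr => T _.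
by rewrite /transition; case: ifP; rewrite // mul0r.
Qed.

Lemma mean_decrement f U :
  \sum_T transition R U T * (f U - f T) = laplacian f U.
Proof.
apply: (mulfI (card_neq0 R hN)); rewrite laplacianE // sum_transition.
by rewrite mulrA divff ?card_neq0 // mul1r sum_adjacent.
Qed.

(** The mean of [f U - f T] is the Laplacian of f at U, that is, the mean of
    [partial v i T U]; antisymmetry of [partial] cancels the rest. *)
Lemma mean_martingale_increment v i f U : poisson_solution v i f ->
  \sum_T transition R U T * (partial v i U T + f U - f T) = 0.
Proof.
move=> [_ fL]; under eq_bigr do rewrite -addrA mulrDr.
rewrite big_split /= mean_decrement /laplacian fL sum_transition -mulrDr.
rewrite -big_split big1 ?mulr0 // => T _ /=.
by rewrite partialN addNr.
Qed.

End StepMeans.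

(** * Integrals of functions of a finite-valued random variable *)

Section FiniteValued.
Local Open Scope classical_set_scope.
Variables (R : realType) (d : measure_display) (Omega : measurableType d).
Variables (P : probability Omega R) (F : finType) (Z : Omega -> F).
Hypothesis mZ : forall z, measurable [set w | Z w = z].
Implicit Types (g : F -> R).

Lemma finite_valuedE g w : g (Z w) = \sum_z g z * \1_[set w | Z w = z] w.
Proof.
rewrite (bigD1 (Z w)) //= big1 ?addr0 => [|z zw]; rewrite indicE.
  by rewrite mem_set ?mulr1.
by rewrite memNset ?mulr0 //= => /eqP; rewrite eq_sym (negbTE zw).
Qed.

Lemma integrable_finite_valued g :
  P.-integrable setT (fun w => (g (Z w))%:E).
Proof.
under eq_fun do rewrite finite_valuedE -sumEFin.
apply: integrable_sum => // z _; under eq_fun do rewrite EFinM.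
by apply: integrableZl => //; apply: integrable_indic => //; rewrite setIT.
Qed.

Lemma integral_finite_valued g :
  (\int[P]_w (g (Z w))%:E = (\sum_z g z * fine (P [set w | Z w = z]))%R%:E)%E.
Proof.
under eq_integral do rewrite finite_valuedE -sumEFin.
rewrite integral_sum //; last first.
  move=> z; under eq_fun do rewrite EFinM.
  by apply: integrableZl => //; exact: integrable_indic.
rewrite -sumEFin; apply: eq_bigr => z _; under eq_integral do rewrite EFinM.
rewrite integralZl //; last exact: integrable_indic.
by rewrite integral_indic // setIT EFinM fineK // fin_num_measure.
Qed.

End FiniteValued.

(** * The Markov property for functions of the past *)

Section Walk.
Local Open Scope classical_set_scope.
Local Open Scope ring_scope.
Variables (R : realType) (N : finType) (d : measure_display).
Variables (Omega : measurableType d) (P : probability Omega R).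
Variable X : nat -> Omega -> {set N}.
Hypothesis hX : coalition_walk P X.
Implicit Types (S T U : {set N}) (t : nat) (w : Omega).

Local Notation history t := {ffun 'I_t.+1 -> {set N}}.

(** A random variable with finitely many values: every event and every function
    that depends on the first steps of the walk is a function of it, so no
    measure theory beyond finite sums is needed for them. *)
Definition past t w : history t := [ffun k : 'I_t.+1 => X k w].

Lemma past_event t (z : history t) :
  [set w | past t w = z] = event_path X t (fun k => z (inord k)).
Proof.
apply/seteqP; split=> w /=.
  by move=> <- k kt; rewrite ffunE inordK.
move=> zw; apply/ffunP => k; rewrite ffunE zw ?inord_val //.
by rewrite -ltnS.
Qed.

Lemma measurable_past t (z : history t) : measurable [set w | past t w = z].
Proof.
rewrite past_event.
have -> : event_path X t (fun k => z (inord k)) =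
    \bigcap_(k in [set k | (k <= t)%N]) [set w | X k w = z (inord k)] by [].
by apply: bigcap_measurableType => k _; exact: (walk_measurable hX).
Qed.

Lemma measurable_past_next t (p : history t * {set N}) :
  measurable [set w | (past t w, X t.+1 w) = p].
Proof.
have -> : [set w | (past t w, X t.+1 w) = p] =
    [set w | X t.+1 w = p.2] `&` [set w | past t w = p.1].
  by apply/seteqP; split=> w /=; [case: p => ? ? [-> ->]|case: p => ? ? /= [-> ->]].
by apply: measurableI; [exact: (walk_measurable hX) | exact: measurable_past].
Qed.

(** The Markov hypothesis with the conditional probability multiplied out: it
    then holds for null histories as well. *)
Lemma prob_past_next t (z : history t) T :
  fine (P [set w | (past t w, X t.+1 w) = (z, T)]) =
  fine (P [set w | past t w = z]) * transition R (z ord_max) T.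
Proof.
have -> : [set w | (past t w, X t.+1 w) = (z, T)] =
    [set w | X t.+1 w = T] `&` [set w | past t w = z].
  by apply/seteqP; split=> w /= [-> ->].
have mT : measurable [set w | X t.+1 w = T] by exact: (walk_measurable hX).
have mz := measurable_past z.
have [z0|z0] := eqVneq (P [set w | past t w = z]) 0%E.
  by rewrite z0 mul0r (subset_measure0 (measurableI _ _ mT mz) mz _ z0) //.
have fz0 : fine (P [set w | past t w = z]) != 0.
  by rewrite fine_eq0 ?fin_num_measure.
apply: (mulfI (invr_neq0 fz0)); rewrite mulKf // mulrC.
rewrite past_event in z0 *; have := walk_markov hX T z0.
rewrite /cond_prob => ->; congr transition; congr (z _).
by apply/val_inj; rewrite /= inordK.
Qed.

Lemma integral_past_next t (H : history t -> {set N} -> R) :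
  (\int[P]_w (H (past t w) (X t.+1 w))%:E =
   \int[P]_w (\sum_T transition R (X t w) T * H (past t w) T)%R%:E)%E.
Proof.
rewrite (integral_finite_valued P (@measurable_past_next t) (fun p => H p.1 p.2)).
under [RHS]eq_integral => w _.
  rewrite (_ : X t w = past t w ord_max); last by rewrite ffunE.
  over.
rewrite (integral_finite_valued P (@measurable_past t)
  (fun z : history t => \sum_T transition R (z ord_max) T * H z T)).
congr EFin.
pose joint z T := H z T * fine (P [set w | (past t w, X t.+1 w) = (z, T)]).
transitivity (\sum_p joint p.1 p.2); first by apply: eq_bigr => -[z T] _.
rewrite -(pair_bigA _ joint) /=.
apply: eq_bigr => z _; rewrite mulr_suml; apply: eq_bigr => T _.
by rewrite /joint prob_past_next; ring.
Qed.

Local Notation traj w := (fun k => X k w).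

Lemma unvisited_past S t w :
  unvisited S (traj w) t = unvisited S (fun k => past t w (inord k)) t.
Proof. by apply: eq_unvisited => k kt; rewrite ffunE inordK. Qed.

Lemma integrable_step S (phi : {set N} -> {set N} -> R) t :
  P.-integrable setT
    (fun w => ((unvisited S (traj w) t)%:R * phi (X t w) (X t.+1 w))%:E).
Proof.
under eq_fun => w.
  rewrite unvisited_past (_ : X t w = past t w ord_max); last by rewrite ffunE.
  over.
exact: (integrable_finite_valued P (@measurable_past_next t)
  (fun p => (unvisited S (fun k => p.1 (inord k)) t)%:R * phi (p.1 ord_max) p.2)).
Qed.

Lemma integrable_stopped_sum S (phi : {set N} -> {set N} -> R) t :
  P.-integrable setT (fun w => (stopped_sum phi S (traj w) t)%:E).
Proof.
under eq_fun do rewrite /stopped_sum -sumEFin.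
by apply: integrable_sum => // s _; exact: integrable_step.
Qed.

(** Whether S is unvisited at time s is decided by the past of s, so each
    increment of a stopped sum can be replaced by its one-step mean. *)
Lemma integral_stopped_sum S (phi psi : {set N} -> {set N} -> R) t :
  (forall U, \sum_T transition R U T * phi U T = \sum_T transition R U T * psi U T) ->
  (\int[P]_w (stopped_sum phi S (traj w) t)%:E =
   \int[P]_w (stopped_sum psi S (traj w) t)%:E)%E.
Proof.
move=> mean.
under eq_integral do rewrite /stopped_sum -sumEFin.
under [RHS]eq_integral do rewrite /stopped_sum -sumEFin.
rewrite !integral_sum //; try by move=> s; exact: integrable_step.
apply: eq_bigr => s _.
have E chi : (\int[P]_w ((unvisited S (traj w) s)%:R * chi (X s w) (X s.+1 w))%:E =
    \int[P]_w ((unvisited S (traj w) s)%:R *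
               \sum_T transition R (X s w) T * chi (X s w) T)%R%:E)%E.
  under eq_integral => w _.
    rewrite unvisited_past {1}(_ : X s w = past s w ord_max); last by rewrite ffunE.
    over.
  rewrite (integral_past_next (fun z T =>
    (unvisited S (fun k => z (inord k)) s)%:R * chi (z ord_max) T)).
  apply: eq_integral => w _; rewrite -unvisited_past ffunE mulr_sumr.
  by congr EFin; apply: eq_bigr => T _; rewrite mulrCA.
by rewrite !E; under eq_integral do rewrite mean.
Qed.

(** * Integrability of the first visit time *)

Hypothesis hN : (0 < #|N|)%N.

Lemma integral_real_cst (c : R) : (\int[P]_w c%:E = c%:E)%E.
Proof.
by rewrite (integral_cst P measurableT) [X in (_ * X)%E]probability_setT mule1.
Qed.

Lemma finite_bound (F : finType) (g : F -> R) :
  exists B, 0 <= B /\ forall z, `|g z| <= B.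
Proof.
exists (\sum_z `|g z|); split=> [|z]; first exact: sumr_ge0.
by rewrite (bigD1 z) //= lerDl sumr_ge0.
Qed.

(** The minimum of t and the first visit time. *)
Definition elapsed S t w : R := stopped_sum (fun _ _ => 1) S (traj w) t.

(** A Lyapunov function h has mean decrement at least 1 at each step before the
    visit, except perhaps at time 0, when the walk may already be at S; the
    constant D pays for that step.  The total decrement telescopes, hence is at
    most 2 B. *)
Lemma elapsed_bounded S : exists K : R,
  forall t, (\int[P]_w (elapsed S t w)%:E <= K%:E)%E.
Proof.
have [h hL] := exists_lyapunov R hN S.
have [B [B0 hB]] := finite_bound h.
have [D [D0 hD]] := finite_bound (laplacian h).
exists (B + B + (1 + D)) => t.
have le1 w : elapsed S t w <=
    stopped_sum (fun U _ => laplacian h U) S (traj w) t + (1 + D).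
  rewrite /elapsed /stopped_sum -lerBlDl -sumrB; case: t => [|t].
    by rewrite big_geq // addr_ge0.
  rewrite big_nat_recl //= -[leRHS]addr0; apply: lerD.
    have := hD (X 0%N w); rewrite ler_norml => /andP[+ _]; rewrite /unvisited /=; lra.
  rewrite big_seq; apply: sumr_le0 => s _; rewrite -mulrBr unvisitedS.
  have [Xs|Xs] := eqVneq (X s.+1 w) S; first by rewrite andbF mul0r.
  by rewrite mulr_ge0_le0 // subr_le0 hL.
have intD : P.-integrable setT (EFin \o cst (1 + D)).
  exact: finite_measure_integrable_cst.
pose L w := stopped_sum (fun U _ => laplacian h U) S (traj w) t.
apply: (@le_trans _ _ (\int[P]_w ((L w)%:E + (1 + D)%:E))%E).
  apply: le_integral => //.
  - exact: integrable_stopped_sum.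
  - by apply: integrableD => //; exact: integrable_stopped_sum.
  - by move=> w _; rewrite -EFinD lee_fin.
rewrite integralD //; last exact: integrable_stopped_sum.
rewrite integral_real_cst [leRHS]EFinD; apply: leeD => //.
rewrite (integral_stopped_sum S (psi := fun U T => h U - h T)); last first.
  move=> U; rewrite mean_decrement // -mulr_suml.
  rewrite [X in X * _](_ : _ = 1) ?mul1r //.
  under eq_bigr do rewrite -[transition _ _ _]mulr1.
  rewrite sum_transition sum_adjacent sumr_const.
  by rewrite mulVf // card_neq0.
apply: (@le_trans _ _ (\int[P]_w (B + B)%:E)%E); last first.
  by rewrite integral_real_cst.
apply: le_integral => //.
- exact: integrable_stopped_sum.
- exact: finite_measure_integrable_cst.
move=> w _; rewrite lee_fin.
have [U ->] := stopped_sum_telescope h S (traj w) t.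
by rewrite (le_trans (ler_norm _)) // (le_trans (ler_normB _ _)) // lerD.
Qed.

(** The first visit time, infinite when S is never visited. *)
Definition total_time S w : \bar R :=
  (\sum_(0 <= s <oo) ((unvisited S (traj w) s)%:R)%:E)%E.

Lemma elapsed_le_total S t w : ((elapsed S t w)%:E <= total_time S w)%E.
Proof.
rewrite /elapsed /stopped_sum -sumEFin; under eq_bigr do rewrite mulr1.
by apply: nneseries_lim_ge => s _ _; rewrite lee_fin.
Qed.

Lemma integrable_unvisited S s :
  P.-integrable setT (fun w => ((unvisited S (traj w) s)%:R)%:E).
Proof.
have := integrable_step S (fun _ _ => 1) s.
by under eq_fun do rewrite mulr1.
Qed.

Lemma integrable_total_time S : P.-integrable setT (total_time S).
Proof.
have mu s := measurable_int P (integrable_unvisited S s).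
have u0 s w : (0 <= ((unvisited S (traj w) s)%:R : R)%:E)%E by rewrite lee_fin.
apply/integrableP; split.
  exact: (ge0_emeasurable_sum (P := xpredT) (fun s w _ _ => u0 s w) (fun s _ => mu s)).
under eq_integral => w _ do rewrite gee0_abs ?nneseries_ge0 //.
rewrite integral_nneseries //.
have [K hK] := elapsed_bounded S.
apply: le_lt_trans (ltry K); apply: lime_le.
  by apply: is_cvg_nneseries => s _ _; exact: integral_ge0.
apply: nearW => t; apply: le_trans (hK t); rewrite -integral_sum //; last first.
  by move=> s; exact: integrable_unvisited.
rewrite le_eqVlt; apply/orP; left; apply/eqP/eq_integral => w _.
by rewrite /elapsed /stopped_sum -sumEFin; under [RHS]eq_bigr do rewrite mulr1.
Qed.

(** On a trajectory that never visits S the total time is infinite, whereas an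
    integrable function is almost everywhere finite. *)
Lemma ae_visited S : {ae P, forall w, first_visit (traj w) S != None}.
Proof.
apply: filterS (integrable_ae measurableT (integrable_total_time S)) => w /(_ I).
move=> fin; apply/eqP => nv.
have le_t t : t%:R <= fine (total_time S w).
  rewrite -lee_fin fineK //; apply: le_trans (elapsed_le_total S t w).
  rewrite lee_fin /elapsed /stopped_sum.
  under eq_bigr do rewrite (first_visit_none _ nv) mulr1.
  by rewrite sumr_const_nat subn0.
have := le_t (Num.bound (fine (total_time S w))).
rewrite leNgt => /negP; apply; apply: archi_boundP.
by rewrite fine_ge0 // nneseries_ge0 // => s _ _; rewrite lee_fin.
Qed.

Lemma ae_start : {ae P, forall w, X 0%N w = finset.set0}.
Proof.
have m0 := walk_measurable hX 0%N finset.set0.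
exists (~` [set w | X 0%N w = finset.set0]); split => //.
  exact: measurableC.
by rewrite probability_setC // (walk_start hX) subee.
Qed.

(** * Optional stopping *)

Lemma stopped_sum_le (phi : {set N} -> {set N} -> R) S : exists C : R,
  0 <= C /\ forall t w, `|stopped_sum phi S (traj w) t| <= C * elapsed S t w.
Proof.
have [C [C0 hC]] := finite_bound (fun p => phi p.1 p.2).
exists C; split=> // t w; rewrite /elapsed /stopped_sum mulr_sumr.
apply: le_trans (ler_norm_sum _ _ _) _; apply: ler_sum => s _.
rewrite mulr1 normrM normr_nat mulrC ler_wpM2r //.
exact: (hC (X s w, X s.+1 w)).
Qed.

(** The factor [1 - unvisited] kills the trajectories that never visit S, where
    the stopped sums need not converge and the path integral is 0; so the limit
    holds everywhere. *)
Lemma measurable_path_integral v i S :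
  measurable_fun setT (fun w => path_integral v i S (traj w) : R).
Proof.
pose y t w : R := (1 - (unvisited S (traj w) t)%:R) *
                  stopped_sum (partial v i) S (traj w) t.
apply: (@measurable_fun_cvg _ _ _ _ y) => [t|w _].
  apply: measurable_funM.
    apply: measurable_funB => //.
    exact/measurable_EFinP/(measurable_int P (integrable_unvisited S t)).
  exact/measurable_EFinP/(measurable_int P (integrable_stopped_sum S _ t)).
suff /cvg_near_cst : \forall t \near \oo, y t w = path_integral v i S (traj w).
  by apply.
case fv: (first_visit (traj w) S) => [tau|].
  have [_ _ uE] := first_visit_some fv.
  exists tau => // t /= taut.
  rewrite /y uE ltnNge taut subr0 mul1r (stopped_sum_visited _ fv taut).
  by rewrite /path_integral fv big_add1.
apply: nearW => t.
by rewrite /y /path_integral fv (first_visit_none _ fv) subrr mul0r.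
Qed.

(** Optional stopping: [W t] has integral 0, is dominated by a multiple of the
    first visit time, and converges almost surely to [path_integral - f S]. *)
Lemma Psi_poisson v i f S : poisson_solution v i f ->
  Psi P X v i S = (f S)%:E.
Proof.
move=> fP; have [f0 _] := fP.
pose phi U V := partial v i U V + f U - f V.
have [C [C0 hC]] := stopped_sum_le phi S.
pose F w := (path_integral v i S (traj w) - f S)%:E.
pose W t w := (stopped_sum phi S (traj w) t)%:E.
have mF : measurable_fun setT F.
  apply/measurable_EFinP/measurable_funB => //.
  exact: measurable_path_integral.
have W0 t : (\int[P]_w W t w = 0)%E.
  rewrite /W (integral_stopped_sum S (psi := fun _ _ => 0)); last first.
    move=> U; rewrite mean_martingale_increment // big1 // => T _.
    by rewrite mulr0.
  by apply: integral0_eq => w _; rewrite /stopped_sum big1 // => s _; rewrite mulr0.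
have cvgW : {ae P, forall w, setT w -> W t w @[t --> \oo] --> F w}.
  apply: filterS2 (ae_visited S) ae_start => w nv X0 _.
  suff /cvg_near_cst : \forall t \near \oo, W t w = F w by apply.
  apply: filterS (path_integral_stopped v i f nv) => t.
  by rewrite /W /F /phi => ->; rewrite X0 f0 addr0.
have intG := integrableZl measurableT C (integrable_total_time S).
have leWG : {ae P, forall w t, setT w -> (`|W t w| <= C%:E * total_time S w)%E}.
  apply: aeW => w t _; rewrite /W abse_EFin.
  apply: (@le_trans _ _ (C%:E * (elapsed S t w)%:E)%E).
    by rewrite -EFinM lee_fin.
  by rewrite lee_wpmul2l // elapsed_le_total.
have [intF _] := dominated_convergence measurableT
  (fun t => measurable_int P (integrable_stopped_sum S phi t)) mF cvgW intG leWG.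
rewrite (_ : [sequence _]_n = cst 0%E); last by apply/funext => t; exact: W0.
move=> /cvg_lim; rewrite lim_cst // => F0.
rewrite /Psi unlock.
transitivity (\int[P]_w (F w + (f S)%:E))%E.
  by apply: eq_integral => w _; rewrite -EFinD subrK.
rewrite integralD //; last exact: finite_measure_integrable_cst.
by rewrite -F0 // add0e integral_real_cst.
Qed.

End Walk.

Theorem theorem5p1 (R : realType) (N : finType) (hN : (0 < #|N|)%N)
    (d : measure_display) (Omega : measurableType d) (P : probability Omega R)
    (X : nat -> Omega -> {set N}) (hX : coalition_walk P X) :
  (forall v : {set N} -> R, coalition_game v ->
     forall (S : {set N}) (i : N), (Phi v i S)%:E = Psi P X v i S) /\
  (forall v : {set N} -> R, coalition_game v ->
     forall i : N, (shapley v i)%:E = Psi P X v i finset.setT).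
Proof.
split=> v _ => [S i|i]; first by rewrite (Psi_poisson hX hN S (PhiP hN v i)).
have fP := PhiP hN v i.
by rewrite (Psi_poisson hX hN _ fP) (poisson_solution_shapley hN fP).
Qed.
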